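(* Let $n,k\in\mathbb{N}$ with $k\ge 2$, and let $f(z)=\sum_{s=0}^\infty \mathcal{P}(n,k,s)\,z^s$ be the generating function of the number $\mathcal{P}(n,k,s)$ of $n$-ary words of length $s$ that contain no streak of length $k$. Then, as formal power series in $z$ with complex coefficients, $$f(z)=\frac{k}{\displaystyle\sum_{s=1}^{k-1}\left(1-\omega_k^{-s}\right)\left(1+\omega_k^s z\right)^n}.$$
   Context: $\mathbb{N}=\{1,2,3,\ldots\}$ and $\omega_k=e^{2\pi i/k}$. An $n$-ary word of length $s$ is a tuple $(a_1,\ldots,a_s)$ with entries in $\{1,2,\ldots,n\}$ (there is exactly one word of length $0$). A streak of length $k$ in a word is a strictly increasing contiguous subword of length $k$, i.e. consecutive entries $a_i<a_{i+1}<\cdots<a_{i+k-1}$. *)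

(* Defs.v *)
From HB Require Import structures.
From mathcomp Require Import all_boot all_order all_algebra.
From mathcomp Require Import boolp reals trigo.
From mathcomp Require Import complex.

Set Implicit Arguments.
Unset Strict Implicit.
Unset Printing Implicit Defensive.

Import Order.TTheory GRing.Theory Num.Theory.

Local Open Scope ring_scope.

(* The ring K[[z]]: a series is its sequence of coefficients, and the product
   is the Cauchy product.  (A record rather than a plain function type, so that
   the pointwise ring structure on functions cannot be picked up instead.) *)
Record fps (K : Type) : Type := Fps { fps_coef : nat -> K }.

Section FormalPowerSeries.
Variable K : comNzRingType.
Implicit Types f g h : fps K.

HB.instance Definition _ := gen_eqMixin (fps K).
HB.instance Definition _ := gen_choiceMixin (fps K).

Lemma fpsP f g : (forall m, fps_coef f m = fps_coef g m) -> f = g.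
Proof. by case: f g => [f] [g] /= fg; congr Fps; apply/funext. Qed.

Definition fps_add f g : fps K := Fps (fun m => fps_coef f m + fps_coef g m).
Definition fps_opp f : fps K := Fps (fun m => - fps_coef f m).
Definition fps_mul f g : fps K :=
  Fps (fun m => \sum_(i < m.+1) fps_coef f i * fps_coef g (m - i)%N).

Definition fpsC (c : K) : fps K := Fps (fun m => if m == 0%N then c else 0).

Definition fpsX : fps K := Fps (fun m => (m == 1%N)%:R).

Fact fps_addA : associative fps_add.
Proof. by move=> f g h; apply: fpsP => m; apply: addrA. Qed.

Fact fps_addC : commutative fps_add.
Proof. by move=> f g; apply: fpsP => m; apply: addrC. Qed.

Fact fps_add0 : left_id (fpsC 0) fps_add.
Proof. by move=> f; apply: fpsP => m /=; rewrite if_same add0r. Qed.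

Fact fps_addN : left_inverse (fpsC 0) fps_opp fps_add.
Proof. by move=> f; apply: fpsP => m /=; rewrite if_same addNr. Qed.

HB.instance Definition _ :=
  GRing.isZmodule.Build (fps K) fps_addA fps_addC fps_add0 fps_addN.

Let trunc m f : {poly K} := \poly_(i < m.+1) fps_coef f i.

Let trunc_mul m n f g : (n <= m)%N ->
  (trunc m f * trunc m g)`_n = fps_coef (fps_mul f g) n.
Proof.
move=> le_nm; rewrite coefM; apply: eq_bigr => i _.
rewrite !coef_poly !ltnS (leq_trans (leq_subr _ _) le_nm).
by rewrite (leq_trans _ le_nm) // -ltnS.
Qed.

Fact fps_mulA : associative fps_mul.
Proof.
move=> f g h; apply: fpsP => m.
have truncM u v n : (n <= m)%N ->
    (trunc m (fps_mul u v))`_n = (trunc m u * trunc m v)`_n.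
  by move=> le_nm; rewrite trunc_mul // coef_poly ltnS le_nm.
rewrite -!(@trunc_mul m) //.
transitivity (trunc m f * (trunc m g * trunc m h))`_m.
  by rewrite !coefM; apply: eq_bigr => i _; rewrite truncM // leq_subr.
rewrite mulrA !coefM; apply: eq_bigr => i _.
by rewrite truncM // -ltnS.
Qed.

Fact fps_mulC : commutative fps_mul.
Proof.
by move=> f g; apply: fpsP => m; rewrite -!(@trunc_mul m) // mulrC.
Qed.

Fact fps_mul1 : left_id (fpsC 1) fps_mul.
Proof.
move=> f; apply: fpsP => m /=.
by rewrite big_ord_recl /= mul1r subn0 big1 ?addr0 // => i _; rewrite mul0r.
Qed.

Fact fps_mulDl : left_distributive fps_mul fps_add.
Proof.
move=> f g h; apply: fpsP => m /=; rewrite -big_split /=.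
by apply: eq_bigr => i _; rewrite mulrDl.
Qed.

Fact fps_1neq0 : fpsC 1 != 0.
Proof.
apply/eqP => /(congr1 (fun f => fps_coef f 0%N)) /= e.
by have := oner_neq0 K; rewrite e eqxx.
Qed.

HB.instance Definition _ :=
  GRing.Zmodule_isComNzRing.Build (fps K)
    fps_mulA fps_mulC fps_mul1 fps_mulDl fps_1neq0.

Definition fps_unit : {pred fps K} := [pred f | `[< exists g, g * f = 1 >]].

Definition fps_inv f : fps K :=
  if pselect (exists g, g * f = 1) is left ex_g then projT1 (cid ex_g) else f.

Fact fps_mulV : {in fps_unit, left_inverse 1 fps_inv *%R}.
Proof.
move=> f /asboolP ex_g; rewrite /fps_inv.
by case: pselect => // ex_g'; case: (cid ex_g').
Qed.

Fact fps_unitP f g : g * f = 1 -> f \in fps_unit.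
Proof. by move=> gf1; apply/asboolP; exists g. Qed.

Fact fps_inv_out : {in [predC fps_unit], fps_inv =1 id}.
Proof.
move=> f /negP nf; rewrite /fps_inv; case: pselect => // ex_g.
by case: nf; apply/asboolP.
Qed.

HB.instance Definition _ :=
  GRing.ComNzRing_hasMulInverse.Build (fps K) fps_mulV fps_unitP fps_inv_out.

End FormalPowerSeries.

Arguments fpsX {K}.

(* The letters 1 < 2 < ... < n are represented by 0 < 1 < ... < n - 1 in 'I_n. *)
Definition has_streak (n k s : nat) (w : s.-tuple 'I_n) : bool :=
  [exists u : k.-tuple 'I_n, infix u w && sorted (fun a b : 'I_n => (a < b)%N) u].

Definition num_streak_free (n k s : nat) : nat :=
  #|[set w : s.-tuple 'I_n | ~~ has_streak k w]|.

Definition streak_free_gf (K : comNzRingType) (n k : nat) : fps K :=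
  Fps (fun s => (num_streak_free n k s)%:R).

Definition omega (R : realType) (k : nat) : R[i] :=
  Complex (cos (2 * pi / k%:R)) (sin (2 * pi / k%:R)).

(* Main.v *)
Require Import Defs.
From mathcomp Require Import all_boot all_order all_algebra.
From mathcomp Require Import reals trigo.
From mathcomp Require Import complex.
From mathcomp Require Import ring lra.

Import Order.TTheory GRing.Theory Num.Theory.
Local Open Scope ring_scope.

(** Let f be the generating function and D the sum in the denominator.  The
    identity is D * f = k, and it splits into an algebraic half and a
    combinatorial half.

    Algebraic half ([coef_denominator]).  The coefficient of z^m in D is
    'C(n, m) times the sum over all s < k of w^(s m) - w^(s (m - 1)), where the
    summand s = 0 vanishes and so can be added freely.  By orthogonality of the
    powers of a primitive k-th root of unity this is k 'C(n, m) e_m with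
    e_m = [k | m] - [k | m - 1], that is, +1 for m = 0 mod k, -1 for
    m = 1 mod k, and 0 otherwise ([coset_sign]).

    Combinatorial half ([sum_sign_streak_free]).  Since 'C(n, m) counts the
    strictly increasing words of length m, the coefficient of z^s in (D / k) f
    counts, with sign e_m, the words of length s together with a cut after m
    letters such that the left part is increasing and the right part has no
    streak of length k.  For each fixed nonempty word these signs cancel
    ([sum_sign_cuts]).  Indeed, let r >= 1 be the length of the first maximal
    increasing run.  The left part is increasing exactly when m <= r, and a
    streak cannot straddle the end of this run, so the right part is streak-free
    exactly when r - m < k and the word without its first run is streak-free.
    The second condition does not depend on m, so only the sum of e_m over the
    window r - k < m <= r, m >= 0, matters.  The partial sums of e telescope to
    e_0 + ... + e_r = [k | r], which makes every window sum with r >= 1 vanish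
    ([window_coset_sign]).  The empty word contributes 1.

    Both halves work over any field with a primitive k-th root of unity
    ([streak_free_gf_prim_root]); such a root forces k to be nonzero in the
    field, and this is what makes D invertible. *)

(** * Runs and streaks *)

Section Runs.
Context {T : eqType} (e : rel T).
Implicit Types (w u : seq T) (k m : nat).

Fixpoint first_run w : nat :=
  if w is x :: w' then
    (if w' is y :: _ then if e x y then first_run w' else 0 else 0).+1%N
  else 0%N.

(** A streak of length [k] starts at a given position exactly when the first run
    of the suffix at this position has length at least [k]; this recursive form
    of streak-freeness is the one that interacts well with cutting off a
    prefix, and [avoidsP] relates it to the definition by contiguous
    subwords. *)
Fixpoint avoids k w : bool :=
  if w is _ :: w' then (first_run w < k)%N && avoids k w' else true.

Lemma first_run_size w : (first_run w <= size w)%N.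
Proof. by elim: w => //= x [|y w] //= IH; case: ifP. Qed.

Lemma sorted_take m w : (m <= size w)%N -> sorted e (take m w) = (m <= first_run w)%N.
Proof.
elim: w m => [|x [|y w] IH] [|[|m]] //= le_m; rewrite ltnS.
by move: (IH m.+1 le_m) => /= ->; case: ifP => // _; rewrite ltn0.
Qed.

Lemma first_run_drop m w : (m < first_run w)%N -> first_run (drop m w) = (first_run w - m)%N.
Proof.
elim: w m => [|x [|y w] IH] [|m] //=; rewrite ltnS.
by case: ifP => // _ lt_m; rewrite IH // subSS.
Qed.

(** Streaks do not cross the end of a run, so the first run and the rest of the
    word can be tested separately. *)
Lemma avoids_run k w : (0 < k)%N ->
  avoids k w = (first_run w < k)%N && avoids k (drop (first_run w) w).
Proof.
move=> k_gt0; elim: w => [|x w IH]; first by rewrite /= k_gt0.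
case: w IH => [|y w] IH //.
have -> : avoids k [:: x, y & w] =
  (first_run [:: x, y & w] < k)%N && avoids k (y :: w) by [].
have -> : first_run [:: x, y & w] = (if e x y then first_run (y :: w) else 0%N).+1 by [].
rewrite [drop _ _]/=; case: ifP => // _; rewrite [in LHS]IH andbA.
congr (_ && _); rewrite andb_idr //; exact: ltnW.
Qed.

(** The only part of the right-hand side that depends on the cut position [m]
    is the length of what remains of the first run. *)
Lemma avoids_drop k w m : (0 < k)%N -> (m <= first_run w)%N ->
  avoids k (drop m w) = (first_run w - m < k)%N && avoids k (drop (first_run w) w).
Proof.
move=> k_gt0; rewrite leq_eqVlt => /orP[/eqP-> | lt_m]; first by rewrite subnn k_gt0.
by rewrite avoids_run // first_run_drop // drop_drop subnK // ltnW.
Qed.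

Lemma prefix_run k w :
  reflect (exists u, [/\ size u = k, sorted e u & prefix u w])
          ((k <= size w) && (k <= first_run w))%N.
Proof.
apply: (iffP andP) => [[le_k le_run]|[u [<- su pu]]].
  exists (take k w); rewrite sorted_take // size_takel //; split=> //.
  by apply/prefixP; exists (drop k w); rewrite cat_take_drop.
have le_u : (size u <= size w)%N by apply: size_prefix.
split=> //; rewrite -sorted_take //.
by move: pu; rewrite prefixE => /eqP ->.
Qed.

Lemma avoidsP k w : (0 < k)%N ->
  reflect (exists u, [/\ size u = k, sorted e u & infix u w]) (~~ avoids k w).
Proof.
move=> k_gt0; elim: w => [|x w IH].
  constructor=> -[u [su _]]; rewrite infixs0 => /eqP u0.
  by move: k_gt0; rewrite -su u0.
have -> : avoids k (x :: w) = (first_run (x :: w) < k)%N && avoids k w by [].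
rewrite negb_and -leqNgt; apply: (iffP orP).
  case=> [le_k | /IH[u [su eu iu]]].
    have /prefix_run[u [su eu pu]] : ((k <= size (x :: w)) && (k <= first_run (x :: w)))%N.
      by rewrite le_k (leq_trans le_k) // first_run_size.
    by exists u; split; rewrite // infix_consl pu.
  by exists u; split; rewrite // infix_consl iu orbT.
move=> [u [su eu]]; rewrite infix_consl => /orP[pu | iu]; [left | right].
  by have /prefix_run/andP[] : exists u, [/\ size u = k, sorted e u & prefix u (x :: w)]
    by exists u.
by apply/IH; exists u.
Qed.

End Runs.

(** * Cancellation of signs over the cuts of a word *)

Section Signs.
Context (K : pzRingType) (k : nat).
Hypothesis k_gt1 : (1 < k)%N.

(** [k %| m + k.-1] says that [m] is 1 modulo [k], without the truncated
    subtraction [m - 1] going wrong at [m = 0]. *)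
Definition coset_sign (m : nat) : K := (k %| m)%:R - (k %| m + k.-1)%:R.

(** The sum telescopes, because the negative part at [m.+1] is the positive part
    at [m]. *)
Lemma sum_coset_sign r : \sum_(m < r.+1) coset_sign m = (k %| r)%:R.
Proof.
elim: r => [|r IH].
  rewrite big_ord1 /coset_sign add0n dvdn0 gtnNdvd ?subr0 //; last by case: k k_gt1.
  by case: k k_gt1 => [|[]].
rewrite big_ord_recr /= IH /coset_sign addSnnS prednK 1?ltnW // dvdn_addl //.
by rewrite addrC subrK.
Qed.

(** For [k <= r] the window sum is the difference of the partial sums up to [r]
    and up to [r - k], and [k] divides both or neither; for [r < k] it is the
    partial sum itself, and [k] does not divide [r] unless [r = 0]. *)
Lemma window_coset_sign r :
  \sum_(m < r.+1) coset_sign m * (r - m < k)%:R = (r == 0)%:R.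
Proof.
have [lt_rk | le_kr] := ltnP r k.
  under eq_bigr => m _ do rewrite (leq_ltn_trans (leq_subr _ _) lt_rk) mulr1.
  rewrite sum_coset_sign; case: r lt_rk => [|r] lt_rk; first by rewrite dvdn0.
  by rewrite gtnNdvd.
have le_wr : ((r - k).+1 <= r.+1)%N by rewrite ltnS leq_subr.
have split_window (m : 'I_r.+1) : coset_sign m * (r - m < k)%:R =
    coset_sign m - (if (m < (r - k).+1)%N then coset_sign m else 0).
  have -> : (m < (r - k).+1)%N = ~~ (r - m < k)%N.
    by rewrite ltnS -leqNgt !leq_subRL // 1?addnC // -ltnS.
  by case: ltnP => _; rewrite ?mulr1 ?mulr0 ?subr0 ?subrr.
rewrite (eq_bigr _ (fun m _ => split_window m)) sumrB -big_mkcond /=.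
rewrite -(big_ord_widen _ coset_sign le_wr) !sum_coset_sign.
rewrite -{1}(subnK le_kr) dvdn_addl // subrr.
by rewrite (gtn_eqF (leq_trans (ltnW k_gt1) le_kr)).
Qed.

(** Only the cuts inside the first run contribute, and by [avoids_drop] they
    contribute a window sum times a factor that does not depend on the cut. *)
Lemma sum_sign_cuts {T : eqType} (e : rel T) (w : seq T) :
  \sum_(m < (size w).+1)
     coset_sign m * (sorted e (take m w) && avoids e k (drop m w))%:R
  = (size w == 0)%:R.
Proof.
have cut (m : 'I_(size w).+1) :
    coset_sign m * (sorted e (take m w) && avoids e k (drop m w))%:R =
    if (m < (first_run e w).+1)%N then
      coset_sign m * (first_run e w - m < k)%:R * (avoids e k (drop (first_run e w) w))%:R
    else 0.
  rewrite sorted_take; last by rewrite -ltnS.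
  rewrite ltnS; have [le_m | _] := leqP m (first_run e w); last by rewrite mulr0.
  by rewrite andTb (avoids_drop _ _ _ _ (ltnW k_gt1)) // -mulnb natrM mulrA.
rewrite (eq_bigr _ (fun m _ => cut m)) -big_mkcond /=.
have le_run : ((first_run e w).+1 <= (size w).+1)%N by rewrite ltnS first_run_size.
rewrite -(big_ord_widen _ (fun m => coset_sign m * (first_run e w - m < k)%:R *
   (avoids e k (drop (first_run e w) w))%:R) le_run).
rewrite -mulr_suml window_coset_sign.
by case: w {cut le_run} => [|x w]; rewrite ?mulr1 // mul0r.
Qed.

End Signs.

(** * From single words to counting words *)

Lemma card_cut {T : finType} (p q : pred (seq T)) (m s : nat) : (m <= s)%N ->
  #|[set w : s.-tuple T | p (take m w) && q (drop m w)]| =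
  (#|[set u : m.-tuple T | p u]| * #|[set v : (s - m).-tuple T | q v]|)%N.
Proof.
move=> le_ms; rewrite -cardsX.
pose glue (uv : m.-tuple T * (s - m).-tuple T) : s.-tuple T :=
  tcast (subnKC le_ms) (cat_tuple uv.1 uv.2).
have glueE uv : glue uv = uv.1 ++ uv.2 :> seq T by rewrite val_tcast.
have glue_inj : injective glue.
  move=> [u v] [u' v'] /(congr1 (@tval _ _)); rewrite !glueE /= => /eqP.
  by rewrite eqseq_cat ?size_tuple // => /andP[/eqP/val_inj-> /eqP/val_inj->].
rewrite -(card_imset _ glue_inj); apply: eq_card => w; rewrite inE.
apply/idP/imsetP => [pq | [[u v]]]; last first.
  rewrite !inE /= => uv ->.
  by rewrite glueE /= take_size_cat ?drop_size_cat ?size_tuple.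
have size_u : size (take m w) == m by rewrite size_takel ?size_tuple.
have size_v : size (drop m w) == (s - m)%N by rewrite size_drop size_tuple.
exists (Tuple size_u, Tuple size_v); first by rewrite !inE.
by apply: val_inj; rewrite /= [RHS]glueE /= cat_take_drop.
Qed.

Definition ord_lt {n : nat} : rel 'I_n := fun a b => (a < b)%N.

Lemma card_increasing (m n : nat) :
  #|[set u : m.-tuple 'I_n | sorted ord_lt u]| = 'C(n, m).
Proof.
rewrite -card_ltn_sorted_tuples; apply: eq_card => u.
by rewrite !inE sorted_map.
Qed.

Lemma has_streak_avoids (n k s : nat) (w : s.-tuple 'I_n) : (0 < k)%N ->
  has_streak k w = ~~ avoids ord_lt k w.
Proof.
move=> k_gt0; apply/existsP/(avoidsP ord_lt _ _ k_gt0) => [[u /andP[iu su]] | [u [eu su iu]]].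
  by exists u; rewrite size_tuple.
by exists (Tuple (introT eqP eu)); rewrite /= iu.
Qed.

Lemma num_streak_freeE (n k s : nat) : (0 < k)%N ->
  num_streak_free n k s = #|[set w : s.-tuple 'I_n | avoids ord_lt k w]|.
Proof.
by move=> k_gt0; apply: eq_card => w; rewrite !inE has_streak_avoids // negbK.
Qed.

(** Double counting of pairs of a word and a cut: summing over the words first
    gives the products on the left, summing over the cuts first gives 0 for each
    nonempty word. *)
Lemma sum_sign_streak_free (K : pzRingType) (n k s : nat) : (1 < k)%N ->
  \sum_(m < s.+1) coset_sign K k m * ('C(n, m) * num_streak_free n k (s - m))%:R
  = (s == 0)%:R.
Proof.
move=> k_gt1.
transitivity (\sum_(w : s.-tuple 'I_n) \sum_(m < s.+1) coset_sign K k m *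
   (sorted ord_lt (take m w) && avoids ord_lt k (drop m w))%:R).
  rewrite exchange_big /=; apply: eq_bigr => m _.
  rewrite -mulr_sumr -card_increasing num_streak_freeE 1?ltnW // -card_cut -1?ltnS //.
  rewrite -sum1_card natr_sum big_mkcond /=; congr (_ * _).
  by apply: eq_bigr => w _; rewrite inE; case: ifP.
have word (w : s.-tuple 'I_n) : \sum_(m < s.+1) coset_sign K k m *
    (sorted ord_lt (take m w) && avoids ord_lt k (drop m w))%:R = (s == 0)%:R.
  by have := sum_sign_cuts K k k_gt1 ord_lt w; rewrite size_tuple.
rewrite (eq_bigr _ (fun w _ => word w)) sumr_const card_tuple card_ord.
by case: s {word} => [|s] /=; rewrite ?expn0 // mul0rn.
Qed.

(** * Coefficients of the denominator *)

Section Series.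
Context {K : comNzRingType}.
Implicit Types f g : fps K.

Lemma coef_fpsD f g m : fps_coef (f + g) m = fps_coef f m + fps_coef g m.
Proof. by []. Qed.

Lemma coef_fpsM f g m :
  fps_coef (f * g) m = \sum_(i < m.+1) fps_coef f i * fps_coef g (m - i).
Proof. by []. Qed.

Lemma coef_fps_sum (I : Type) (r : seq I) (F : I -> fps K) m :
  fps_coef (\sum_(i <- r) F i) m = \sum_(i <- r) fps_coef (F i) m.
Proof.
elim: r => [|i r IH]; last by rewrite !big_cons coef_fpsD IH.
by rewrite !big_nil /=; case: (m == 0)%N.
Qed.

Lemma coef_fpsCM c f m : fps_coef (fpsC c * f) m = c * fps_coef f m.
Proof.
rewrite coef_fpsM big_ord_recl subn0 big1 ?addr0 // => i _.
by rewrite /= mul0r.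
Qed.

Lemma coef_fpsXM f m :
  fps_coef (fpsX * f) m = if m is m'.+1 then fps_coef f m' else 0.
Proof.
rewrite coef_fpsM big_ord_recl /= mul0r add0r.
case: m => [|m]; first by rewrite big_ord0.
rewrite big_ord_recl /= mul1r subSS subn0 big1 ?addr0 // => i _.
by rewrite /= mul0r.
Qed.

Lemma fpsC_nat m : fpsC m%:R = m%:R :> fps K.
Proof.
elim: m => [|m IH]; first by apply: fpsP.
rewrite -!natr1 -IH; apply: fpsP => -[|i]; rewrite coef_fpsD //=.
by rewrite addr0.
Qed.

(** Multiplying by [1 + c z] acts on coefficients by Pascal's rule, so induction on
    [n] avoids expanding the power in the ring of series. *)
Lemma coef_binomial_power (c : K) (n m : nat) :
  fps_coef ((1 + fpsC c * fpsX) ^+ n) m = c ^+ m *+ 'C(n, m).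
Proof.
elim: n m => [|n IH] m.
  by rewrite expr0 /=; case: m => [|m] //=; rewrite bin0n.
rewrite exprS mulrDl mul1r -mulrA coef_fpsD coef_fpsCM coef_fpsXM IH.
case: m => [|m]; first by rewrite mulr0 addr0 !bin0.
by rewrite IH binS mulrnDr mulrnAr -exprS.
Qed.

End Series.

(** Geometric sum of the powers of [w ^+ j], which is a root of ['X^k - 1] and
    equals 1 exactly when [k] divides [j]. *)
Lemma sum_prim_root_exp (K : idomainType) (k : nat) (w : K) (j : nat) :
  k.-primitive_root w ->
  \sum_(s < k) w ^+ s ^+ j = k%:R * (k %| j)%:R.
Proof.
move=> w_prim; under eq_bigr => s _ do rewrite exprAC.
rewrite (prim_order_dvd w_prim); case: eqP => [-> | /eqP wj_neq1].
  under eq_bigr => s _ do rewrite expr1n.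
  by rewrite sumr_const card_ord mulr1.
apply/eqP; rewrite mulr0 -(mulrI_eq0 _ (mulfI (_ : w ^+ j - 1 != 0))) ?subr_eq0 //.
by rewrite -subrX1 exprAC (prim_expr_order w_prim) expr1n subrr.
Qed.

Lemma coef_denominator (K : fieldType) (n k : nat) (w : K) (m : nat) :
  k.-primitive_root w ->
  fps_coef (\sum_(1 <= s < k)
     fpsC (1 - w ^- s) * (1 + fpsC (w ^+ s) * fpsX) ^+ n) m
  = k%:R * (coset_sign K k m *+ 'C(n, m)).
Proof.
move=> w_prim; have k_gt0 := prim_order_gt0 w_prim.
(* Trading w^-s for a nonnegative power makes both halves of the coefficient
   instances of [sum_prim_root_exp], and produces the k.-1 of [coset_sign]. *)
have wV s : w ^- s = w ^+ s ^+ k.-1.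
  have w_neq0 : w ^+ s != 0 by rewrite expf_neq0 // (prim_root_eq0 w_prim) -lt0n.
  apply: (mulfI w_neq0); rewrite divff // -exprS prednK // exprAC.
  by rewrite (prim_expr_order w_prim) expr1n.
have term s : fps_coef (fpsC (1 - w ^- s) * (1 + fpsC (w ^+ s) * fpsX) ^+ n) m =
    (w ^+ s ^+ m - w ^+ s ^+ (m + k.-1)) *+ 'C(n, m).
  rewrite coef_fpsCM coef_binomial_power wV mulrnAr mulrBl mul1r exprD.
  by rewrite [_ ^+ k.-1 * _]mulrC.
(* The summand s = 0 has the factor 1 - 1. *)
have -> : \sum_(1 <= s < k)
     fpsC (1 - w ^- s) * (1 + fpsC (w ^+ s) * fpsX) ^+ n
   = \sum_(0 <= s < k)
     fpsC (1 - w ^- s) * (1 + fpsC (w ^+ s) * fpsX) ^+ n.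
  rewrite [RHS]big_ltn // expr0 invr1 subrr.
  suff -> : fpsC (0 : K) = 0 by rewrite mul0r add0r.
  by apply: fpsP.
rewrite coef_fps_sum (eq_bigr _ (fun s _ => term s)) big_mkord sumrMnl.
by rewrite sumrB !sum_prim_root_exp // -mulrBr mulrnAr.
Qed.

(** * The generating function *)

Theorem streak_free_gf_prim_root (K : fieldType) (n k : nat) (w : K) :
  (1 < k)%N -> k.-primitive_root w ->
  (\sum_(1 <= s < k)
     fpsC (1 - w ^- s) * (1 + fpsC (w ^+ s) * fpsX) ^+ n) * streak_free_gf K n k
  = k%:R.
Proof.
move=> k_gt1 w_prim; apply: fpsP => s; rewrite coef_fpsM.
have -> : fps_coef (k%:R : fps K) s = k%:R * (s == 0)%:R.
  by rewrite -fpsC_nat; case: s => [|s] /=; rewrite ?mulr1 ?mulr0.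
rewrite -(sum_sign_streak_free K n k s k_gt1) mulr_sumr; apply: eq_bigr => m _.
by rewrite coef_denominator // -[_ *+ 'C(_, _)]mulr_natr natrM !mulrA.
Qed.

(** The order [d] of [omega] divides [k]; it cannot be smaller, because
    [cos x = 1 - 2 sin^2 (x / 2)] is different from 1 for [0 < x < 2 pi]. *)
Lemma omega_prim (R : realType) (k : nat) : (0 < k)%N ->
  k.-primitive_root (omega R k).
Proof.
move=> k_gt0.
set t : R := 2 * pi / k%:R.
have moivre j : omega R k ^+ j = Complex (cos (t *+ j)) (sin (t *+ j)).
  elim: j => [|j IH]; first by rewrite expr0 mulr0n cos0 sin0.
  rewrite exprS IH mulrS cosD sinD.
  by apply/eqP; rewrite eq_complex /=; apply/andP; split; apply/eqP; ring.
have k_neq0 : k%:R != 0 :> R by rewrite pnatr_eq0 -lt0n.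
have cos_neq1 j : (0 < j < k)%N -> cos (t *+ j) != 1.
  move=> /andP[j_gt0 lt_jk].
  set h := pi * (j%:R / k%:R) : R.
  have -> : t *+ j = h *+ 2 by rewrite /t /h; field.
  have : 0 < sin h.
    apply: sin_gt0_pi; rewrite mulr_gt0 ?pi_gt0 ?divr_gt0 ?ltr0n //=.
    by rewrite gtr_pMr ?pi_gt0 // ltr_pdivrMr ?ltr0n // mul1r ltr_nat.
  move=> sin_gt0; rewrite cos_mulr2n cos2sin2.
  suff : 0 < sin h ^+ 2 by move=> ?; apply/eqP; lra.
  by rewrite exprn_gt0.
have omegak : omega R k ^+ k = 1.
  rewrite moivre (_ : t *+ k = pi *+ 2) ?cos2pi ?sin2pi //.
  by rewrite /t; field.
have [d d_prim dvd_dk] := prim_order_exists k_gt0 omegak.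
have [lt_dk | le_kd] := ltnP d k; last first.
  have e : k = d by apply/eqP; rewrite eqn_leq le_kd dvdn_leq.
  by rewrite [X in X.-primitive_root _]e.
have d_gt0 := prim_order_gt0 d_prim.
have := prim_expr_order d_prim; rewrite moivre => -[cos1 _].
have : cos (t *+ d) != 1 by rewrite cos_neq1 // d_gt0.
by rewrite cos1 eqxx.
Qed.

Theorem corollary3p7 (R : realType) (n k : nat) (hn : (0 < n)%N) (hk : (2 <= k)%N) :
  let D : fps R[i] :=
    \sum_(1 <= s < k)
      fpsC (1 - omega R k ^- s) * (1 + fpsC (omega R k ^+ s) * fpsX) ^+ n in
  D \is a GRing.unit /\ streak_free_gf R[i] n k = k%:R / D.
Proof.
move=> D; have k_prim := omega_prim R k (ltnW hk).
have Df : D * streak_free_gf R[i] n k = k%:R := streak_free_gf_prim_root _ n k _ hk k_prim.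
have kV : fpsC k%:R^-1 * k%:R = 1 :> fps R[i].
  apply: fpsP => s; rewrite -fpsC_nat coef_fpsCM /=.
  by case: s => [|s]; rewrite ?mulr0 // mulVf // (prim_root_natf_neq0 k_prim).
have unitD : D \is a GRing.unit.
  apply: (@fps_unitP _ _ (fpsC k%:R^-1 * streak_free_gf R[i] n k)).
  by rewrite -mulrA [_ * D]mulrC Df.
by split=> //; rewrite -Df mulrAC divrr // mul1r.
Qed.
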